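(* Let $K\subseteq\mathbb{R}^n$ be a convex body satisfying $$\max_{y\in e_n^\perp}\mathrm{vol}_1(K\cap(y+\langle e_n\rangle))=\mathrm{vol}_1(K\cap\langle e_n\rangle).$$ Then $$\frac{\binom{2n}{n}}{n^n}\,n\int_0^\infty r^{n-1}\mu(K\cap(re_n+K))\,dr\leq\frac{\big(\mu(S_{e_n}(K)+C_{n-1})\big)^{n+1}}{\big(G_{n-1}(P_{e_n^\perp}(K))\big)^n}.$$
   Context: A convex body is a compact convex set with non-empty interior. $(e_i)_{i=1}^n$ is the canonical orthonormal basis of $\mathbb{R}^n$, $\langle e_n\rangle$ is the line spanned by $e_n$, $e_n^\perp$ is the linear hyperplane orthogonal to $e_n$ (identified with $\mathbb{R}^{n-1}$), and $P_{e_n^\perp}$ is the orthogonal projection onto $e_n^\perp$. $\mathrm{vol}_k$ is $k$-dimensional Lebesgue measure (on $k$-dimensional affine subspaces). For $A\subseteq e_n^\perp$, $G_{n-1}(A)=|A\cap\mathbb{Z}^n|$ is the number of lattice points in $A$. The measure $\mu$ on $\mathbb{R}^n=\mathbb{R}^{n-1}\times\mathbb{R}$ is the product of the counting measure of $\mathbb{Z}^{n-1}$ and 1-dimensional Lebesgue measure, i.e. $\mu(A)=\sum_{y\in e_n^\perp\cap\mathbb{Z}^n}\mathrm{vol}_1(A\cap(y+\langle e_n\rangle))$. $C_{n-1}=(-1,1)^{n-1}\times\{0\}\subseteq\mathbb{R}^n$, and $+$ between sets is the Minkowski sum. $S_{e_n}(K)$ is the Steiner symmetrization of $K$ with respect to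 $e_n^\perp$; for compact $K$, $S_{e_n}(K)=\{(y,t)\in\mathbb{R}^{n-1}\times\mathbb{R}: y\in P_{e_n^\perp}(K),\ |t|\leq\tfrac12\mathrm{vol}_1(K\cap(y+\langle e_n\rangle))\}$. *)

(* Defs.v *)
From HB Require Import structures.
From mathcomp Require Import all_boot all_order all_algebra.
From mathcomp Require Import all_classical all_reals all_analysis.
Set Implicit Arguments.
Unset Strict Implicit.
Unset Printing Implicit Defensive.
Import Order.TTheory GRing.Theory Num.Theory.
Import numFieldNormedType.Exports.
Local Open Scope classical_set_scope.
Local Open Scope ring_scope.

(* The ambient space R^n, n >= 1, is 'rV[R]_d.+1 with n = d.+1, so that
   d = n - 1 throughout. Its library topology (sup norm) is the Euclidean one. *)

Section Definitions.
Context {R : realType} {d : nat}.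
Implicit Types (A B K : set 'rV[R]_d.+1) (x y : 'rV[R]_d.+1).

Definition dot x y : R := (x *m y^T) 0 0.

Definition e_n : 'rV[R]_d.+1 := delta_mx 0 ord_max.

Definition convex_body K : Prop :=
  [/\ compact K, convex_set K & interior K !=set0].

Definition en_perp : set 'rV[R]_d.+1 := [set x | dot x e_n = 0].

Definition proj_en_perp x : 'rV[R]_d.+1 := x - dot x e_n *: e_n.

Definition Zn : set 'rV[R]_d.+1 := [set x | forall j, x 0 j \is a Num.int].

(* vol_1 (A `&` (y + <e_n>)): since e_n is a unit vector, t |-> y + t e_n is an
   isometric parametrization of the line y + <e_n>. *)
Definition vol1_fiber A y : \bar R :=
  @lebesgue_measure R [set t : R | A (y + t *: e_n)].

Definition latcount A : \bar R := counting (A `&` Zn).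

Definition mu A : \bar R := \esum_(y in en_perp `&` Zn) vol1_fiber A y.

(* C_{n-1} = (-1,1)^{n-1} x {0} *)
Definition cube : set 'rV[R]_d.+1 :=
  [set x | (forall j, j != ord_max -> -1 < x 0 j < 1) /\ x 0 ord_max = 0].

Definition minkowski_sum A B : set 'rV[R]_d.+1 :=
  [set x + y | x in A & y in B].

(* The formula valid for compact K: the point (y, t) is y + t e_n. *)
Definition steiner K : set 'rV[R]_d.+1 :=
  [set x | exists y (t : R),
     [/\ (proj_en_perp @` K) y,
         (`|t|%:E <= (2^-1)%:E * vol1_fiber K y)%E
       & x = y + t *: e_n]].

Definition is_maximum (S : set (\bar R)) (m : \bar R) : Prop :=
  S m /\ ubound S m.

End Definitions.

(* Main.v *)
Require Import Defs.
From mathcomp Require Import all_boot all_order all_algebra.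
From mathcomp Require Import finmap.
From mathcomp Require Import all_classical all_reals all_analysis.
From mathcomp Require Import measurable_realfun.
From mathcomp Require Import zify ring lra.
Set Implicit Arguments.
Unset Strict Implicit.
Unset Printing Implicit Defensive.
Import Order.TTheory GRing.Theory Num.Theory.
Import numFieldNormedType.Exports.
Local Open Scope classical_set_scope.
Local Open Scope ring_scope.

(** Write n = d + 1, f(y) for the length of the fibre of K over y, A for the
set of lattice points of the projection of K, and G for the size of A.

The fibre of K `&` (r e_n + K) over y has length max (f(y) - r, 0), so
integrating against r^(n-1) fibre by fibre turns the left-hand side into a
constant times the sum of f^(n+1) over A ([covariogram_moment]). On the right,
the fibre of S(K) + C over a lattice point z has length F(z) >= f(p) for every
p in z + C lying in the projection of K ([steiner_fiber_ge]). What remains is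
a discrete Berwald inequality between the (n+1)-st moment of f and the first
moment of F ([moment_le]).

Let N(t) and N'(t) count the lattice points, the latter in a large box, where
f >= t and F >= t respectively, and let
h(t) = G (1 - t/al)^(n-1) on [0, al], zero beyond, with al chosen so that h and
N' have the same integral. Suppose N(t1) > h(t1). By concavity of f, the
combination (1 - l) A + l {f >= t1} lies in {f >= l t1}, so the discrete
Brunn-Minkowski inequality bounds N'(l t1)^(1/(n-1)) below by the chord from
G^(1/(n-1)) to N(t1)^(1/(n-1)). That chord lies above the affine function
h^(1/(n-1)), which starts from the same value (for n = 1 all the counts
involved are 0 or 1); hence h <= N' before t1. So there
is a crossing point ts with h <= N' before ts and N <= h after ts
([crossing]). With N <= N' this gives, for every t >= 0,
      t^n N(t) + ts^n h(t) <= ts^n N'(t) + t^n h(t).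
Integrating, the two terms in ts^n cancel and the moment of h is a Beta
integral ([berwald_moment]).

The discrete Brunn-Minkowski inequality ([discrete_BM]) counts the lattice
points at sup-distance < 1 from the combinations. It goes by induction on the
dimension, in the manner of Bonnesen: the slices of either set are divided by
the size of the largest one, the one-dimensional inequality over the integers
([one_dim_BM]) is applied to the super-level sets of these ratios, the result
is integrated over the level ([layer_cake_ge0]), and convexity of the power
function ([power_mean_perspective]) gives the inequality between roots. *)

(** * Integers near convex combinations *)

Section OneDim.
Variable R : realType.
Implicit Types (l c w S t : R).

(** A discrete layer-cake principle: a weighted sum is the integral over the
level t of the weights sitting strictly above t. The integral is unrolled from
the lowest value upwards, which keeps everything a finite sum. *)
Lemma layer_cake_ge0 (s : seq (R * R)) t0 :
  {in s, forall x, t0 <= x.2} ->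
  (forall t, t0 <= t -> 0 <= \sum_(x <- s | t < x.2) x.1) ->
  0 <= \sum_(x <- s) x.1 * (x.2 - t0).
Proof.
pose r := [rel x y : R * R | x.2 <= y.2].
have r_tot : total r by move=> x y; exact: le_total.
have r_trans : transitive r by move=> x y z; exact: le_trans.
have ps : perm_eq (sort r s) s by rewrite perm_sort.
have: sorted r (sort r s) by apply: sort_sorted.
move=> srt h1 h2; rewrite -(perm_big _ ps) /=.
have {}h1 : {in sort r s, forall x, t0 <= x.2}.
  by move=> x; rewrite mem_sort; exact: h1.
have {}h2 t : t0 <= t -> 0 <= \sum_(x <- sort r s | t < x.2) x.1.
  by move=> /h2; rewrite (perm_big _ ps).
move: (sort r s) srt h1 h2 => {ps} {}s.
elim: s t0 => [|x s IH] t0 srt h1 h2; first by rewrite big_nil.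
have x0 : t0 <= x.2 by apply: h1; rewrite inE eqxx.
have xs : {in s, forall y, x.2 <= y.2}.
  move: srt; rewrite /= path_sortedE // => /andP[/allP xs _] y ys.
  exact: xs.
have -> : \sum_(i <- x :: s) i.1 * (i.2 - t0) =
  (x.2 - t0) * \sum_(i <- x :: s) i.1 + \sum_(i <- s) i.1 * (i.2 - x.2).
  rewrite !big_cons [in RHS]mulrDr mulr_sumr -addrA -big_split /=; congr (_ + _).
    by rewrite mulrC.
  by apply: eq_bigr => i _; ring.
apply: addr_ge0; last first.
  apply: IH => //; first exact: path_sorted srt.
  move=> t xt; have := h2 t (le_trans x0 xt).
  by rewrite big_cons ltNge xt.
move: x0; rewrite le_eqVlt => /orP[/eqP->|x0].
  by rewrite subrr mul0r.
apply: mulr_ge0; first by rewrite subr_ge0 ltW.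
have := h2 t0 (lexx _); rewrite !big_cons x0.
rewrite [X in _ + X]big_seq_cond [X in _ -> _ <= _ + X]big_seq.
congr (_ <= _ + _); apply: eq_bigl => y.
by case ys: (y \in s) => //=; rewrite (lt_le_trans x0)// xs.
Qed.

(** The invariant carried along a chain of reals read from right to left, c
being the leftmost one. Asking for the fractional part of c on top of S
pays for the next gap to the left: a shift by w inside the same unit interval
raises the bound by w without supplying an integer. *)
Definition many_near (P : R -> Prop) c S := exists D : seq int,
  [/\ uniq D, {in D, forall z, exists2 p, P p & `|z%:~R - p| < 1},
      {in D, forall z, Num.floor c <= z}
    & S + (c - (Num.floor c)%:~R) <= (size D)%:R].

Lemma floor_itv_sub c : 0 <= c - (Num.floor c)%:~R < 1.
Proof.
have := floor_le_tmp c; have := floorD1_gt c.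
by rewrite intrD => h1 h2; apply/andP; split; lra.
Qed.

Lemma many_near_base (P : R -> Prop) c : P c -> many_near P c 1.
Proof.
move=> Pc; have /andP[h0 h1] := floor_itv_sub c.
have [e|ne] := eqVneq (c - (Num.floor c)%:~R) 0.
  exists [:: Num.floor c]; split=> //=.
  - by move=> z; rewrite inE => /eqP->; exists c => //; rewrite ltr_norml; lra.
  - by move=> z; rewrite inE => /eqP->.
  - by rewrite e; lra.
have {}ne : 0 < c - (Num.floor c)%:~R by rewrite lt_def ne.
exists [:: Num.floor c; Num.floor c + 1]; split=> /=.
- by rewrite inE andbT; lia.
- move=> z; rewrite !inE => /orP[] /eqP->; exists c => //;
    rewrite ?intrD ltr_norml; apply/andP; split; lra.
- by move=> z; rewrite !inE => /orP[] /eqP->; lia.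
- by rewrite (natrD _ 1 1); lra.
Qed.

(** If c and c' have the same floor, the slack of the invariant absorbs w. If the
floor drops by one, the floor of c is a new integer. If it drops further, all
integers at distance < 1 from c are new, and w <= 1 suffices. *)
Lemma many_near_step (P P' : R -> Prop) c c' w S :
  (forall p, P' p -> P p) -> P c -> 0 <= w <= 1 -> c + w <= c' ->
  many_near P' c' S -> many_near P c (S + w).
Proof.
move=> PP' Pc /andP[w0 w1] cc' [D [uD nD fD sD]].
have /andP[h0 h1] := floor_itv_sub c.
have {}nD : {in D, forall z, exists2 p, P p & `|z%:~R - p| < 1}.
  by move=> z /nD[p P'p ?]; exists p => //; exact: PP'.
have ff : Num.floor c <= Num.floor c' by apply: le_floor; lra.
have [e|ne] := eqVneq (Num.floor c') (Num.floor c).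
  by exists D; split=> //; [rewrite -e|move: sD; rewrite e; lra].
have {}ff : Num.floor c + 1 <= Num.floor c' by lia.
have fc z : z \in D -> Num.floor c + 1 <= z by move=> /fD; lia.
have near0 : `|(Num.floor c)%:~R - c| < 1.
  by rewrite ltr_norml; apply/andP; split; lra.
have [e|ne'] := eqVneq (Num.floor c') (Num.floor c + 1).
  exists (Num.floor c :: D); split=> /=.
  - by rewrite uD andbT; apply/negP => /fc; lia.
  - by move=> z; rewrite inE => /orP[/eqP->|/nD//]; exists c.
  - by move=> z; rewrite inE => /orP[/eqP->//|/fc]; lia.
  - by rewrite -natr1; move: sD; rewrite e intrD; lra.
have {}ff : Num.floor c + 2 <= Num.floor c' by lia.
have {}fc z : z \in D -> Num.floor c + 2 <= z by move=> /fD; lia.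
have [E [uE nE fE sE]] := @many_near_base (fun x => x = c) c erefl.
have {nE}nE z : z \in E -> `|z%:~R - c| < 1.
  by move=> /nE[p ->].
have /andP[h0' h1'] := floor_itv_sub c'.
exists (E ++ D); split.
- rewrite cat_uniq uE uD andbT; apply/hasPn => z /fc fz; apply/negP => /nE.
  have : (Num.floor c + 2)%:~R <= z%:~R :> R by rewrite ler_int.
  by rewrite intrD ltr_norml => ? /andP[_ ?]; lra.
- by move=> z; rewrite mem_cat => /orP[/nE|/nD//]; exists c.
- by move=> z; rewrite mem_cat => /orP[/fE//|/fc]; apply: le_trans; rewrite lerDl.
- by rewrite size_cat natrD; lra.
Qed.

(** Run through the sums (1 - l) i + l j along the staircase that increases i
with j fixed at the least element of J, then j with i fixed at the greatest
element of I: the gaps are at least 1 - l, then at least l. *)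
Lemma one_dim_BM l (I J : seq int) : 0 <= l <= 1 -> uniq I -> uniq J ->
  I != [::] -> J != [::] ->
  exists D : seq int, [/\ uniq D,
    {in D, forall z, exists i j, [/\ i \in I, j \in J &
       `|z%:~R - ((1 - l) * i%:~R + l * j%:~R)| < 1]}
    & (1 - l) * (size I)%:R + l * (size J)%:R <= (size D)%:R].
Proof.
move=> /andP[l0 l1] uI uJ I0 J0.
pose P (I J : seq int) (p : R) := exists i j,
  [/\ i \in I, j \in J & p = (1 - l) * i%:~R + l * j%:~R].
pose c (i j : int) : R := (1 - l) * i%:~R + l * j%:~R.
have gap (i i' : int) : i < i' -> i%:~R + 1 <= i'%:~R :> R.
  by move=> ii'; rewrite -(intrD _ i 1) ler_int; lia.
have fromJ i j J' : sorted <%R (j :: J') ->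
    many_near (P [:: i] (j :: J')) (c i j) ((1 - l) + l * (size (j :: J'))%:R).
  elim: J' j => [|j' J' IH] j /=.
    move=> _; rewrite mulr1 subrK; apply: many_near_base.
    by exists i, j; rewrite !inE !eqxx.
  move=> /andP[jj' /IH IH']; rewrite -natr1 mulrDr mulr1 addrA.
  apply: many_near_step IH'; rewrite ?l0 ?l1 //.
  - move=> p [i0 [j0 [hi hj ->]]]; exists i0, j0; split=> //.
    by rewrite inE hj orbT.
  - by exists i, j; rewrite !inE !eqxx.
  - by rewrite /c -addrA lerD2l -[X in _ + X](mulr1 l) -mulrDr ler_wpM2l ?gap.
have fromI i j I' J' : sorted <%R (i :: I') -> sorted <%R (j :: J') ->
    many_near (P (i :: I') (j :: J')) (c i j)
     ((1 - l) * (size (i :: I'))%:R + l * (size (j :: J'))%:R).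
  move=> sI sJ; elim: I' i sI => [|i' I' IH] i /=.
    by move=> _; rewrite mulr1; apply: fromJ.
  move=> /andP[ii' /IH IH'].
  rewrite -[X in (1 - l) * X]natr1 [(1 - l) * (_ + 1)]mulrDr mulr1 addrAC.
  apply: many_near_step IH'; rewrite ?subr_ge0 ?l1 ?gerBl //.
  - move=> p [i0 [j0 [hi hj ->]]]; exists i0, j0; split=> //.
    by rewrite inE hi orbT.
  - by exists i, j; rewrite !inE !eqxx.
  - by rewrite /c addrAC lerD2r -[X in _ + X](mulr1 (1 - l)) -mulrDr ler_wpM2l ?gap ?subr_ge0.
have sI : sorted <%R (sort <=%R I) by rewrite sort_lt_sorted.
have sJ : sorted <%R (sort <=%R J) by rewrite sort_lt_sorted.
case eI: (sort <=%R I) sI => [|i I'] sI.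
  by move: I0; rewrite -size_eq0 -(size_sort <=%R) eI.
case eJ: (sort <=%R J) sJ => [|j J'] sJ.
  by move: J0; rewrite -size_eq0 -(size_sort <=%R) eJ.
have [D [uD nD fD sD]] := fromI _ _ _ _ sI sJ.
exists D; split=> //.
  move=> z /nD[_ [i0 [j0 [hi hj ->]]] h]; exists i0, j0; split=> //.
    by rewrite -(mem_sort <=%R) eI.
  by rewrite -(mem_sort <=%R) eJ.
rewrite -(size_sort <=%R I) -(size_sort <=%R J) eI eJ.
have /andP[? _] := floor_itv_sub (c i j).
lra.
Qed.

End OneDim.

(** * The discrete Brunn-Minkowski inequality *)

Section BM.
Variable R : realType.

(** By induction on m, the step being Chebyshev's sum inequality for the
similarly ordered pairs (x, y) and (x^m, y^m). *)
Lemma convex_expr m (p x y : R) : 0 <= p <= 1 -> 0 <= x -> 0 <= y ->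
  ((1 - p) * x + p * y) ^+ m <= (1 - p) * x ^+ m + p * y ^+ m.
Proof.
move=> /andP[p0 p1] x0 y0; elim: m => [|m IH]; first by rewrite !expr0; lra.
have s0 : 0 <= (1 - p) * x + p * y by rewrite addr_ge0 ?mulr_ge0 ?subr_ge0.
rewrite exprS; apply: le_trans (ler_wpM2l s0 IH) _; rewrite !exprS.
(* Chebyshev: x - y and x^m - y^m have the same sign. *)
have cheb : 0 <= (x - y) * (x ^+ m - y ^+ m).
  have [xy|yx] := leP x y.
    by rewrite mulr_le0 ?subr_le0 // lerXn2r.
  by rewrite mulr_ge0 ?subr_ge0 ?lerXn2r ?nnegrE // ltW.
rewrite -subr_ge0; set u := x ^+ m in cheb *; set v := y ^+ m in cheb *.
have -> : (1 - p) * (x * u) + p * (y * v) -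
  ((1 - p) * x + p * y) * ((1 - p) * u + p * v) =
  (p * (1 - p)) * ((x - y) * (u - v)) by ring.
by rewrite mulr_ge0 // mulr_ge0 // subr_ge0.
Qed.

(** The joint convexity of (a, s) |-> a^(m+1) / s^m, the perspective of the
power function; Bonnesen's bound on the left of the induction step becomes
Brunn-Minkowski through it. *)
Lemma power_mean_perspective m (l a b s t : R) : 0 <= l <= 1 -> 0 <= a -> 0 <= b ->
  0 < s -> 0 < t ->
  ((1 - l) * a + l * b) ^+ m.+1 <= ((1 - l) * s + l * t) ^+ m *
     ((1 - l) * (a ^+ m.+1 / s ^+ m) + l * (b ^+ m.+1 / t ^+ m)).
Proof.
move=> /andP[l0 l1] a0 b0 s0 t0.
set c := (1 - l) * s + l * t.
have c0 : 0 < c.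
  rewrite /c; have [->|ln0] := eqVneq l 0; first by rewrite subr0 mul1r mul0r addr0.
  by rewrite ltr_wpDl ?mulr_ge0 ?mulr_gt0 ?subr_ge0 // ?lt_def ?ln0 // ltW.
have sc : 1 - l * t / c = (1 - l) * s / c.
  by rewrite -{1}(@divff _ c) ?gt_eqF // -mulrBl /c addrK.
have := @convex_expr m.+1 (l * t / c) (a / s) (b / t) _ _ _.
rewrite sc => H; have {}H := H _ _ _.
have lt1 : 0 <= l * t / c <= 1.
  apply/andP; split; first by rewrite divr_ge0 ?mulr_ge0 // ltW.
  by rewrite -subr_ge0 sc divr_ge0 ?mulr_ge0 ?subr_ge0 // ltW.
have := H lt1 (divr_ge0 a0 (ltW s0)) (divr_ge0 b0 (ltW t0)).
have cm : 0 < c ^+ m.+1 by rewrite exprn_gt0.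
move=> {H} /(ler_wpM2l (ltW cm)); rewrite -exprMn.
have -> : c * ((1 - l) * s / c * (a / s) + l * t / c * (b / t)) =
   (1 - l) * a + l * b by field; rewrite !gt_eqF.
move/le_trans; apply; rewrite le_eqVlt; apply/orP; left; apply/eqP.
rewrite !expr_div_n !exprS; field.
by rewrite !expf_eq0 !gt_eqF ?andbF.
Qed.

Lemma argmax_seq (T : eqType) (s : seq T) (f : T -> R) : s != [::] ->
  exists2 x, x \in s & {in s, forall y, f y <= f x}.
Proof.
elim: s => [//|a s IH] _; case: (eqVneq s [::]) => [->|/IH[x xs xm]].
  by exists a; rewrite ?inE // => y; rewrite inE => /eqP->.
have [ax|xa] := leP (f a) (f x).
  exists x; first by rewrite inE xs orbT.
  by move=> y; rewrite inE => /orP[/eqP->|/xm].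
exists a; first by rewrite inE eqxx.
by move=> y; rewrite inE => /orP[/eqP->//|/xm/le_trans]; apply; exact: ltW.
Qed.

(** In exponent 0 only 1 has a root; there the sets counted are singletons. *)
Lemma pos_root m (x : R) : 0 < x -> (m = 0%N -> x = 1) ->
  exists2 r, 0 < r & r ^+ m = x.
Proof.
case: m => [x0 /(_ erefl) ->|m x0 _]; first by exists 1; rewrite ?ltr01.
exists (x `^ (m.+1%:R^-1)); first exact: powR_gt0.
by rewrite -powR_mulrn ?powR_ge0 // -powRrM mulVf // powRr1 // ltW.
Qed.

(** Coordinates are read with default value 0, which makes those beyond the
common size satisfy the inequality trivially. *)
Definition near_comb (l : R) (x y z : seq int) := forall k : nat,
  `|(z`_k)%:~R - ((1 - l) * (x`_k)%:~R + l * (y`_k)%:~R)| < 1.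

Lemma near_comb_cons l i j k x y z :
  `|k%:~R - ((1 - l) * i%:~R + l * j%:~R)| < 1 -> near_comb l x y z ->
  near_comb l (i :: x) (j :: y) (k :: z).
Proof. by move=> h h' []. Qed.

(** For t < 1 both super-level sets are nonempty because f and g reach the
value 1; that is why slices are normalised by the largest one before this is
applied. The super-level sets of h then contain the integers provided in
dimension one, and summing over t gives the claim. *)
Lemma functional_BM (l : R) (I J : seq int) (f g : int -> R) (h : int -> R) :
  0 <= l <= 1 -> uniq I -> uniq J ->
  {in I, forall i, 0 <= f i <= 1} -> {in J, forall j, 0 <= g j <= 1} ->
  (exists2 i, i \in I & f i = 1) -> (exists2 j, j \in J & g j = 1) ->
  forall Ks : seq int, {in Ks, forall k, 0 <= h k} ->
  (forall i j k, i \in I -> j \in J ->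
    `|k%:~R - ((1 - l) * i%:~R + l * j%:~R)| < 1 ->
     k \in Ks /\ Num.min (f i) (g j) <= h k) ->
  (1 - l) * (\sum_(i <- I) f i) + l * (\sum_(j <- J) g j)
    <= \sum_(k <- Ks) h k.
Proof.
move=> l01 uI uJ f01 g01 [i0 i0I fi0] [j0 j0J gj0] Ks h0 hh.
pose s := [seq (1 : R, h k) | k <- Ks] ++
  ([seq (- (1 - l), f i) | i <- I] ++ [seq (- l, g j) | j <- J]).
have := @layer_cake_ge0 R s 0 _ _.
rewrite /s !big_cat !big_map /=.
under eq_bigr do rewrite subr0 mul1r.
under [X in _ + (X + _)]eq_bigr do rewrite subr0 mulNr.
under [X in _ + (_ + X)]eq_bigr do rewrite subr0 mulNr.
rewrite !sumrN -!mulr_sumr => H; rewrite -subr_ge0 opprD; apply: H.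
  move=> x; rewrite !mem_cat => /orP[|/orP[]] /mapP[k kI ->] /=.
  - exact: h0.
  - by have /andP[] := f01 _ kI.
  - by have /andP[] := g01 _ kI.
move=> t t0; rewrite !big_cat !big_map /=.
have cnt (T : Type) (L : seq T) (c : R) (P : pred T) :
    \sum_(x <- L | P x) c = c * (size (seq.filter P L))%:R.
  by rewrite -big_filter big_const_seq count_predT iter_addr_0 mulr_natr.
rewrite !cnt mul1r !mulNr -opprD subr_ge0.
have [t1|t1] := leP 1 t.
  rewrite (_ : seq.filter _ I = [::]); last first.
    apply/eqP; rewrite -[_ == _]negbK -has_filter; apply/hasPn => i /f01 /andP[_ fi].
    by rewrite -leNgt (le_trans fi).
  rewrite (_ : seq.filter _ J = [::]); last first.
    apply/eqP; rewrite -[_ == _]negbK -has_filter; apply/hasPn => i /g01 /andP[_ fi].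
    by rewrite -leNgt (le_trans fi).
  by rewrite !mulr0 addr0.
have [|||//|D [uD nD sD]] := @one_dim_BM R l (seq.filter (fun i => t < f i) I)
  (seq.filter (fun j => t < g j) J) l01.
- exact: filter_uniq.
- exact: filter_uniq.
- by rewrite -has_filter; apply/hasP; exists i0 => //; rewrite fi0.
- by rewrite -has_filter; apply/hasP; exists j0 => //; rewrite gj0.
apply: le_trans sD _; rewrite ler_nat; apply: uniq_leq_size => // k /nD.
move=> [i [j []]]; rewrite !mem_filter => /andP[ti iI] /andP[tj jJ] kn.
have [kK hk] := hh _ _ _ iI jJ kn.
by rewrite kK andbT; apply: lt_le_trans hk; rewrite lt_min ti.
Qed.

Lemma near_floor (k : int) (c : R) : `|k%:~R - c| < 1 ->
  k == Num.floor c \/ k == Num.floor c + 1.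
Proof.
rewrite ltr_norml => /andP[k1 k2].
have /andP[f1 f2] := floor_itv_sub c.
have : (Num.floor c - 1)%:~R < k%:~R :> R by rewrite intrB; lra.
have : k%:~R < (Num.floor c + 2)%:~R :> R by rewrite intrD; lra.
by rewrite !ltr_int => {k1 k2 f1 f2} h1 h2; apply/orP; lia.
Qed.

Definition slice (A : seq (seq int)) (i : int) :=
  [seq behead x | x <- A & head 0 x == i].

Lemma mem_slice A i x m : {in A, forall y, size y = m.+1} ->
  (x \in slice A i) = (i :: x \in A).
Proof.
move=> sA; apply/mapP/idP => [[y]|iA]; last first.
  by exists (i :: x) => //; rewrite mem_filter /= eqxx.
rewrite mem_filter => /andP[/eqP <- yA] ->.
by move: yA (sA _ yA); case: y.
Qed.

Lemma slice_uniq A i m : {in A, forall y, size y = m.+1} -> uniq A ->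
  uniq (slice A i).
Proof.
move=> sA uA; rewrite map_inj_in_uniq ?filter_uniq // => x y.
rewrite !mem_filter => /andP[/eqP hx xA] /andP[/eqP hy yA] e.
move: (sA _ xA) (sA _ yA) hx hy e => {xA yA}.
by case: x => [//|? ?]; case: y => [//|? ?] /= _ _ -> -> ->.
Qed.

Lemma size_slices A : 
  (size A = \sum_(i <- undup [seq head 0%R x | x <- A]) size (slice A i))%N.
Proof.
under eq_bigr do rewrite size_map size_filter -sum1_count.
rewrite (exchange_big_dep predT) //= -sum1_size big_seq [RHS]big_seq.
apply: eq_bigr => x xA; rewrite -big_filter sum1_size.
have -> : [seq i <- undup [seq head 0 x | x <- A] | head 0 x == i] = [:: head 0 x] ; last by [].
set L := undup _; have uL : uniq L by exact: undup_uniq.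
have xL : head 0 x \in L by rewrite mem_undup map_f.
under eq_filter do rewrite eq_sym.
by rewrite filter_pred1_uniq.
Qed.

(** The inequality |D|^(1/m) >= (1 - l) |A|^(1/m) + l |B|^(1/m), with a and b in
place of the roots on the right so that m = 0 is included. *)
Theorem discrete_BM m (l : R) (A B : seq (seq int)) (a b : R) : 0 <= l <= 1 ->
  uniq A -> uniq B -> A != [::] -> B != [::] ->
  {in A, forall x, size x = m} -> {in B, forall x, size x = m} ->
  0 <= a -> 0 <= b -> a ^+ m <= (size A)%:R -> b ^+ m <= (size B)%:R ->
  exists D : seq (seq int), [/\ uniq D, {in D, forall z, size z = m},
     {in D, forall z, exists x y, [/\ x \in A, y \in B & near_comb l x y z]}
   & ((1 - l) * a + l * b) ^+ m <= (size D)%:R].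
Proof.
elim: m A B a b => [|m IH] A B a b l01 uA uB A0 B0 sA sB a0 b0 aA bB.
  have in0 (C : seq (seq int)) : C != [::] -> {in C, forall x, size x = 0%N} -> [::] \in C.
    case: C => // c C _ sC.
    by have /size0nil <- := sC c (mem_head _ _); exact: mem_head.
  exists [:: [::]]; split; [by []| | |by rewrite expr0].
    by move=> z; rewrite inE => /eqP->.
  move=> z; rewrite inE => /eqP->; exists [::], [::]; split; try exact: in0.
  by move=> k; rewrite !nth_nil !mulr0 addr0 subr0 normr0.
pose I := undup [seq head 0 x | x <- A]; pose J := undup [seq head 0 x | x <- B].
pose f i : R := (size (slice A i))%:R; pose g j : R := (size (slice B j))%:R.
have uI : uniq I by exact: undup_uniq.
have uJ : uniq J by exact: undup_uniq.
have slice0 (C : seq (seq int)) i : {in C, forall x, size x = m.+1} ->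
    i \in undup [seq head 0 x | x <- C] -> slice C i != [::].
  move=> sC; rewrite mem_undup => /mapP[x xC ->].
  suff : behead x \in slice C (head 0 x) by case: slice.
  by rewrite (mem_slice _ _ sC); move: xC (sC _ xC); case: x.
have slice_size (C : seq (seq int)) i : {in C, forall x, size x = m.+1} ->
    {in slice C i, forall x, size x = m}.
  by move=> sC x; rewrite (mem_slice _ _ sC) => /sC [].
have slice1 (C : seq (seq int)) i : {in C, forall x, size x = m.+1} ->
    uniq C -> i \in undup [seq head 0 x | x <- C] -> m = 0%N -> size (slice C i) = 1%N.
  move=> sC uC iC m0; have := slice0 _ _ sC iC; have := slice_uniq i sC uC.
  have := slice_size _ i sC; rewrite m0.
  case: slice => [//|x [//|y s]] h /=.
  have /size0nil -> := h x (mem_head _ _).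
  have /size0nil -> : size y = 0%N by apply: h; rewrite !inE eqxx orbT.
  by rewrite !inE eqxx.
have undup0 (C : seq (seq int)) : C != [::] -> undup [seq head 0 x | x <- C] != [::].
  rewrite -!size_eq0 => C0; apply/negP => /eqP/size0nil e.
  case: C C0 e => // x C _ e; suff : head 0 x \in [::] by [].
  by rewrite -e mem_undup /= inE eqxx.
have fpos i : i \in I -> 0 < f i.
  by move=> /(slice0 _ _ sA); rewrite /f ltr0n lt0n size_eq0.
have gpos j : j \in J -> 0 < g j.
  by move=> /(slice0 _ _ sB); rewrite /g ltr0n lt0n size_eq0.
have [i0 i0I maxf] := argmax_seq f (undup0 _ A0).
have [j0 j0J maxg] := argmax_seq g (undup0 _ B0).
have F0 := fpos _ i0I; have G0 := gpos _ j0J.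
have [s s0 sm] := pos_root F0 (fun e => congr1 _ (slice1 _ _ sA uA i0I e)).
have [t t0 tm] := pos_root G0 (fun e => congr1 _ (slice1 _ _ sB uB j0J e)).
set c := (1 - l) * s + l * t.
have c0 : 0 < c.
  move: (l01) => /andP[l0 l1].
  rewrite /c; have [->|ln0] := eqVneq l 0; first by rewrite subr0 mul1r mul0r addr0.
  by rewrite ltr_wpDl ?mulr_ge0 ?mulr_gt0 ?subr_ge0 // ?lt_def ?ln0 // ltW.
have cm0 : 0 < c ^+ m by rewrite exprn_gt0.
(* The normalised ratio guaranteed to the slice pair (i, j): the induction
   hypothesis, scaled by the m-th root of v, yields at least v c^m points. *)
pose v i j := Num.min (f i / f i0) (g j / g j0).
pose nearp k i j : bool := `|k%:~R - ((1 - l) * i%:~R + l * j%:~R)| < 1 :> R.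
(* Over height k, keep the set obtained from the best pair of slices near k. *)
have HE k : exists E : seq (seq int), [/\ uniq E, {in E, forall z, size z = m},
     {in E, forall z, exists x y, [/\ x \in A, y \in B & near_comb l x y (k :: z)]}
   & forall i j, i \in I -> j \in J -> nearp k i j -> v i j <= (size E)%:R / c ^+ m].
  pose ps := [seq p <- [seq (i, j) | i <- I, j <- J] | nearp k p.1 p.2].
  have mps i j : ((i, j) \in ps) = [&& nearp k i j, i \in I & j \in J].
    rewrite mem_filter /=; congr (_ && _).
    apply/allpairsP/andP => [[[i' j'] /= [? ? [-> ->]]]//|[? ?]].
    by exists (i, j).
  have [e|/(argmax_seq (fun p => v p.1 p.2))[[i j] ijp vmax]] := eqVneq ps [::].
    exists [::]; split=> // i j iI jJ kn.
    by have := mps i j; rewrite e iI jJ kn.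
  move: ijp; rewrite mps => /and3P[kn iI jJ].
  have v0 : 0 < v i j.
    by rewrite /v lt_min !divr_gt0 ?fpos ?gpos.
  have v1 : m = 0%N -> v i j = 1.
    move=> m0; rewrite /v /f /g !slice1 //.
    by rewrite !divr1 minxx.
  have [r r0 rm] := pos_root v0 v1.
  have [||||||||||E [uE sE nE cE]] := IH (slice A i) (slice B j) (r * s) (r * t) l01.
  - exact: slice_uniq sA uA.
  - exact: slice_uniq sB uB.
  - exact: slice0.
  - exact: slice0.
  - exact: slice_size.
  - exact: slice_size.
  - by rewrite mulr_ge0 // ltW.
  - by rewrite mulr_ge0 // ltW.
  - by rewrite exprMn rm sm -ler_pdivlMr // ge_min lexx.
  - by rewrite exprMn rm tm -ler_pdivlMr // ge_min lexx orbT.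
  exists E; split=> //.
    move=> z /nE[x [y [xA yB nz]]]; exists (i :: x), (j :: y).
    rewrite -(mem_slice i x sA) -(mem_slice j y sB); split=> //.
    exact: near_comb_cons.
  move=> i' j' iI' jJ' kn'.
  rewrite (le_trans (vmax (i', j') _)) ?mps ?kn' ?iI' //= ler_pdivlMr //.
  apply: le_trans cE; rewrite le_eqVlt -rm -exprMn; apply/orP; left; apply/eqP.
  by rewrite /c; congr (_ ^+ _); ring.
have [E HE'] := boolp.choice HE.
pose cc i j : R := (1 - l) * i%:~R + l * j%:~R.
pose Ks := undup (flatten [seq [:: Num.floor (cc i j); Num.floor (cc i j) + 1] | i <- I, j <- J]).
have memK i j k : i \in I -> j \in J -> nearp k i j -> k \in Ks.
  move=> iI jJ kn; rewrite mem_undup; apply/flattenP.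
  exists [:: Num.floor (cc i j); Num.floor (cc i j) + 1].
    by apply/allpairsP; exists (i, j).
  by rewrite !inE; exact/orP/near_floor.
pose D := [seq k :: z | k <- Ks, z <- E k].
exists D; split.
- apply: allpairs_uniq_dep => //.
  + exact: undup_uniq.
  + by move=> k _; have [] := HE' k.
  + by move=> [k z] [k' z'] /= _ _ [-> ->].
- move=> z /allpairsPdep[k [z' [_ zE ->]]] /=.
  by have [_ ->] := HE' k.
- move=> z /allpairsPdep[k [z' [_ zE ->]]].
  by have [_ _ nE _] := HE' k; exact: nE.
rewrite size_allpairs_dep sumnE big_map natr_sum.
have := @functional_BM l I J (fun i => f i / f i0) (fun j => g j / g j0)
  (fun k => (size (E k))%:R / c ^+ m) l01 uI uJ _ _ _ _ Ks _ _.
rewrite -!mulr_suml => H.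
have {}H : (1 - l) * ((\sum_(i <- I) f i) / f i0) +
     l * ((\sum_(i <- J) g i) / g j0) <=
     (\sum_(i <- Ks) (size (E i))%:R) / c ^+ m.
  apply: H.
  - by move=> i iI; rewrite divr_ge0 // ler_pdivrMr // mul1r maxf.
  - by move=> i iI; rewrite divr_ge0 // ler_pdivrMr // mul1r maxg.
  - by exists i0 => //; rewrite divff // gt_eqF.
  - by exists j0 => //; rewrite divff // gt_eqF.
  - by move=> k _; rewrite divr_ge0 // ltW.
  - move=> i j k iI jJ kn; split; first exact: memK kn.
    by have [_ _ _ /(_ i j)] := HE' k; apply.
move: H; rewrite ler_pdivlMr // mulrC; apply: le_trans.
have eA : \sum_(i <- I) f i = (size A)%:R by rewrite size_slices natr_sum.
have eB : \sum_(i <- J) g i = (size B)%:R by rewrite size_slices natr_sum.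
rewrite eA eB; apply: le_trans (power_mean_perspective m l01 a0 b0 s0 t0) _.
move: (l01) => /andP[l0 l1].
rewrite -/c ler_wpM2l ?(ltW cm0) // -sm -tm.
by rewrite lerD // ler_wpM2l ?subr_ge0 // ler_wpM2r // invr_ge0 exprn_ge0 // ltW.
Qed.
End BM.

(** * Truncated Beta densities *)

Section Tent.
Variable R : realType.
Local Notation leb := (@lebesgue_measure R).

(** One family covers every integrand below: exponents (0, 0) give the indicator
of t <= c, (d, 1) the covariogram of a segment of length c times r^d, and (0, m) the
profile of a cone of height c. *)
Definition bump (a b : nat) (c t : R) : R := t ^+ a * (c - t) ^+ b * (t <= c)%R%:R.

Lemma bump_ge0 a b c t : 0 <= t -> 0 <= bump a b c t.
Proof.
move=> t0; rewrite /bump; case: (leP t c) => [tc|_]; last by rewrite /= mulr0.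
by rewrite /= mulr1 mulr_ge0 ?exprn_ge0 ?subr_ge0.
Qed.

Lemma measurable_bump D a b c : measurable_fun D (bump a b c).
Proof.
apply: measurable_funM; first by apply: measurable_funM;
  apply: measurable_funX => //; exact: measurable_funB.
rewrite (_ : (fun t => _) = \1_(`]-oo, c])) //; last first.
  by apply/funext => t; rewrite indicE mem_setE in_itv.
Qed.

(** That is, c^(a+b+1) B(a+1, b+1) with B the Beta function. *)
Definition bump_mass (a b : nat) (c : R) : R :=
  c ^+ (a + b).+1 * (a`! * b`!)%:R / ((a + b).+1)`!%:R.

(** The recursion on b is integration by parts; a polynomial primitive makes the
fundamental theorem of calculus applicable at once. *)
Lemma bump_primitive (c : R) b a : exists p : {poly R},
  [/\ p^`() = 'X^a * (c%:P - 'X) ^+ b, p.[0] = 0 & p.[c] = bump_mass a b c].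
Proof.
have n0 k : k.+1%:R != 0 :> R by rewrite pnatr_eq0.
have f0 k : k`!%:R != 0 :> R by rewrite pnatr_eq0 -lt0n fact_gt0.
elim: b a => [|b IH] a.
  exists ((a.+1%:R)^-1 *: 'X^(a.+1)); split.
  - by rewrite derivZ derivXn -mul_polyC -[X in _ * X]mulr_natl mulrA -polyC_natr -polyCM mulVf ?mul1r ?expr0 ?mulr1.
  - by rewrite hornerZ hornerXn expr0n mulr0.
  - rewrite /bump_mass hornerZ hornerXn addn0 muln1 factS natrM; move: (n0 a) (f0 a).
    by move: a.+1%:R a`!%:R => x y hx hy; field; rewrite hx hy.
have [q [dq q0 qc]] := IH a.+1.
exists ((a.+1%:R)^-1 *: ('X^(a.+1) * (c%:P - 'X) ^+ b.+1 + b.+1%:R *: q)); split.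
- rewrite derivZ derivD derivM derivZ dq derivXn deriv_exp derivB derivC derivX.
  rewrite sub0r /= mulN1r -(mulr_natl 'X^a) -(mulr_natl (- _)) -!mul_polyC polyC_natr.
  have h : (a.+1%:R^-1)%:P * a.+1%:R = 1 :> {poly R}.
    by rewrite -polyC_natr -polyCM mulVf.
  rewrite -[RHS]mul1r -[X in _ = X * _]h; move: ((a.+1%:R^-1)%:P) (a.+1%:R : {poly R}) (b.+1%:R : {poly R}) => u v w.
  by move: ('X^a) 'X^(a.+1) ((_ - _) ^+ b.+1) ((_ - _) ^+ b) => x y z t; ring.
- by rewrite hornerZ hornerD hornerM hornerXn expr0n mul0r hornerZ q0 mulr0 addr0 mulr0.
rewrite hornerZ hornerD hornerM hornerXn horner_exp hornerD hornerN hornerC hornerX.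
rewrite subrr expr0n /= mulr0 add0r hornerZ qc /bump_mass addSnnS.
rewrite (factS a) (factS b); move: (f0 (a + b.+1).+1).
move: ((a + b.+1).+1)`!%:R => g hg; rewrite !natrM; move: (n0 a).
by move: a.+1%:R => u hu; field; rewrite hu hg.
Qed.

Lemma integral_bump a b c : 0 <= c ->
  (\int[leb]_(t in `[0%R, +oo[) (bump a b c t)%:E = (bump_mass a b c)%:E)%E.
Proof.
move=> c0; have [p [dp p0 pc]] := bump_primitive c b a.
have -> : (\int[leb]_(t in `[0%R, +oo[) (bump a b c t)%:E =
    \int[leb]_(t in `[0%R, c]) (p^`().[t])%:E)%E.
  rewrite integral_mkcond [RHS]integral_mkcond; apply: eq_integral => t _.
  rewrite !patchE !mem_setE !in_itv /= andbT dp /bump.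
  rewrite hornerM hornerXn horner_exp hornerD hornerC hornerN hornerX.
  by case: (leP 0 t) => //= _; case: (leP t c) => _; rewrite /= ?mulr1 ?mulr0.
have [c00|cn0] := eqVneq c 0.
  by rewrite c00 set_itv1 integral_set1 /bump_mass exprS !mul0r.
have {}c0 : 0 < c by rewrite lt_def cn0.
rewrite (@continuous_FTC2 _ _ (horner p)) //.
- by rewrite p0 pc -EFinB subr0.
- by apply: continuous_subspaceT; exact: continuous_horner.
- split.
  + by move=> x _; exact: derivable_horner.
  + by apply: cvg_at_right_filter; exact: continuous_horner.
  + by apply: cvg_at_left_filter; exact: continuous_horner.
- by move=> x _; rewrite derivE.
Qed.

(** A weight p.1 on the density with exponents p.2.1 and cutoff p.2.2. *)
Definition wsum (L : seq (R * (nat * nat * R))) (t : R) : R :=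
  \sum_(p <- L) p.1 * bump p.2.1.1 p.2.1.2 p.2.2 t.

Lemma integral_wsum L : {in L, forall p, 0 <= p.1 /\ 0 <= p.2.2} ->
  (\int[leb]_(t in `[0%R, +oo[) (wsum L t)%:E =
   (\sum_(p <- L) p.1 * bump_mass p.2.1.1 p.2.1.2 p.2.2)%:E)%E.
Proof.
elim: L => [|p L IH] hL; rewrite /wsum.
  under eq_integral do rewrite big_nil.
  by rewrite integral0 big_nil.
under eq_integral do rewrite big_cons EFinD.
have hL' : {in L, forall p, 0 <= p.1 /\ 0 <= p.2.2}.
  by move=> q qL; apply: hL; rewrite inE qL orbT.
have [p1 p2] := hL p (mem_head _ _).
have mb (q : R * (nat * nat * R)) D : measurable_fun D (fun t => q.1 * bump q.2.1.1 q.2.1.2 q.2.2 t).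
  by apply: measurable_funM => //; exact: measurable_bump.
rewrite ge0_integralD //=.
- rewrite [X in (_ + X)%E](IH hL') big_cons EFinD; congr (_ + _)%E.
  under eq_integral do rewrite EFinM.
  rewrite ge0_integralZl_EFin //.
  + by rewrite integral_bump.
  + by move=> t; rewrite /= in_itv /= andbT => t0; rewrite lee_fin bump_ge0.
  + by apply/measurable_EFinP; exact: measurable_bump.
- by move=> t; rewrite /= in_itv /= andbT => t0; rewrite lee_fin mulr_ge0 ?bump_ge0.
- by apply/measurable_EFinP; exact: mb.
- move=> t; rewrite /= in_itv /= andbT => t0; rewrite lee_fin big_seq sumr_ge0 // => q qL.
  by rewrite mulr_ge0 ?bump_ge0 //; have [] := hL' _ qL.
- by apply/measurable_EFinP; apply: measurable_sum => q; exact: mb.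
Qed.

Lemma wsum_comparison L M : {in L, forall p, 0 <= p.1 /\ 0 <= p.2.2} ->
  {in M, forall p, 0 <= p.1 /\ 0 <= p.2.2} ->
  (forall t, 0 <= t -> wsum L t <= wsum M t) ->
  \sum_(p <- L) p.1 * bump_mass p.2.1.1 p.2.1.2 p.2.2 <=
  \sum_(p <- M) p.1 * bump_mass p.2.1.1 p.2.1.2 p.2.2.
Proof.
move=> hL hM LM; rewrite -lee_fin -!integral_wsum //.
have mw D N : measurable_fun D (EFin \o wsum N).
  apply/measurable_EFinP; apply: measurable_sum => q.
  by apply: measurable_funM => //; exact: measurable_bump.
apply: ge0_le_integral => //.
- move=> t; rewrite /= in_itv /= andbT => t0; rewrite lee_fin /wsum big_seq sumr_ge0 // => q qL.
  by rewrite mulr_ge0 ?bump_ge0 //; have [] := hL _ qL.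
- exact: mw.
- exact: mw.
- by move=> t; rewrite /= in_itv /= andbT => t0; rewrite lee_fin LM.
Qed.

End Tent.

(** * The crossing argument of Berwald *)

Section Berwald.
Variable R : realType.

Definition num_ge (s : seq R) (t : R) : R := \sum_(x <- s) (t <= x)%R%:R.

Lemma num_ge_ge0 s t : 0 <= num_ge s t.
Proof. by rewrite sumr_ge0. Qed.

Lemma num_geE s t : num_ge s t = (size [seq x <- s | t <= x])%:R.
Proof. by rewrite /num_ge -natr_sum size_filter -sumn_count sumnE big_map. Qed.

(** The level counts of a cone of height al over a base of size G. *)
Definition profile m (G al t : R) := G / al ^+ m * bump 0 m al t.

Lemma profile_ge0 m (G al t : R) : 0 <= G -> 0 < al -> 0 <= t ->
  0 <= profile m G al t.
Proof.
by move=> G0 al0 t0; rewrite mulr_ge0 ?bump_ge0 ?divr_ge0 ?exprn_ge0 // ltW.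
Qed.

Lemma profileE m (g al t : R) : 0 < al ->
  profile m (g ^+ m) al t = if t <= al then (g * (1 - t / al)) ^+ m else 0.
Proof.
move=> al0; rewrite /profile /bump; case: leP => _; last by rewrite /= !mulr0.
rewrite expr0 /= mul1r mulr1 -expr_div_n -exprMn; congr (_ ^+ _).
by field; rewrite gt_eqF.
Qed.

Section Crossing.
Variables (m : nat) (f F : seq R) (al : R).
Let G : R := (size f)%:R.
Hypothesis al0 : 0 < al.
Hypothesis f0 : (0 < size f)%N.
Hypothesis f1 : m = 0%N -> size f = 1%N.
Hypothesis BM : forall t1 l a b, 0 <= t1 -> has (>= t1) f -> 0 <= l <= 1 ->
  0 <= a -> 0 <= b -> a ^+ m <= (size f)%:R -> b ^+ m <= num_ge f t1 ->
  ((1 - l) * a + l * b) ^+ m <= num_ge F (l * t1).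

(** If the level count exceeds the conical profile at t1, then the chord given
by [BM] between the levels 0 and t1 stays above the profile. *)
Lemma profile_le_below t t1 : 0 <= t -> t < t1 ->
  profile m G al t1 < num_ge f t1 -> profile m G al t <= num_ge F t.
Proof.
move=> t0 tt1 h1.
have G0 : 0 < G by rewrite ltr0n.
have [g g0 gm] := pos_root G0 (fun e => congr1 _ (f1 e)).
have t10 : 0 < t1 by exact: le_lt_trans tt1.
have N1 : 0 < num_ge f t1 by apply: le_lt_trans h1; rewrite profile_ge0 // ltW.
have hasf : has (>= t1) f.
  by move: N1; rewrite num_geE ltr0n size_filter -has_count.
move: h1; rewrite -gm !profileE //; case: (leP t al) => tal h1; last exact: num_ge_ge0.
pose l := t / t1.
have l0 : 0 <= l by rewrite divr_ge0 // ltW.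
have l1 : l <= 1 by rewrite ler_pdivrMr // mul1r ltW.
have lt : l * t1 = t by rewrite divfK // gt_eqF.
(* The truncation at 0 covers t1 > al, where the profile vanishes. *)
pose b := Num.max 0 (g * (1 - t1 / al)).
have b0 : 0 <= b by rewrite le_max lexx.
have e : g * (1 - t / al) = (1 - l) * g + l * (g * (1 - t1 / al)).
  by rewrite -lt; ring.
have pos : 0 <= g * (1 - t / al).
  by rewrite mulr_ge0 ?(ltW g0) // subr_ge0 ler_pdivrMr // mul1r.
have posb : 0 <= (1 - l) * g + l * b.
  by rewrite addr_ge0 // mulr_ge0 ?subr_ge0 // ltW.
rewrite -[X in num_ge _ X]lt; apply: le_trans (@BM t1 l g b _ _ _ _ _ _ _); rewrite ?l0 ?l1 ?(ltW t10) ?(ltW g0) ?gm //.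
  apply: lerXn2r; rewrite ?nnegrE // e.
  by rewrite lerD2l ler_wpM2l // le_max lexx orbT.
(* A positive level count is at least 1, which matters for 0 ^+ 0 = 1. *)
have one : 1 <= num_ge f t1.
  by move: N1; rewrite num_geE ltr0n ler1n.
case: (leP t1 al) h1 => t1al h1.
  rewrite /b max_r ?(ltW h1) //.
  by rewrite mulr_ge0 ?(ltW g0) // subr_ge0 ler_pdivrMr // mul1r.
rewrite /b max_l; last first.
  by rewrite pmulr_rle0 // subr_le0 ler_pdivlMr // mul1r ltW.
by apply: le_trans one; case: (m) => [|k]; rewrite ?expr0 // expr0n ler01.
Qed.

(** The crossing point is the supremum of the levels where the count of f exceeds
the profile, or 0 when there are none. *)
Lemma crossing : exists ts, [/\ 0 <= ts,
  forall t, 0 <= t < ts -> profile m G al t <= num_ge F t &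
  forall t, ts < t -> num_ge f t <= profile m G al t].
Proof.
pose T : set R := [set t | 0 <= t /\ profile m G al t < num_ge f t].
have G0 : 0 < G by rewrite ltr0n.
have [T0|/set0P nT] := eqVneq T set0.
  exists 0; split=> // [t /andP[? ?]|t t0]; first by lra.
  by rewrite leNgt; apply/negP => tT; rewrite -[False]/(set0 t) -T0; split=> //; exact: ltW.
have ubT : ubound T (\sum_(x <- f) `|x|).
  move=> t [t0 h]; rewrite leNgt; apply/negP => ft.
  have : 0 < num_ge f t by apply: le_lt_trans h; rewrite profile_ge0 // ltW.
  rewrite num_geE ltr0n size_filter -has_count => /hasP[x xf /= tx].
  have : `|x| <= \sum_(y <- f) `|y| by rewrite (big_rem _ xf) /= lerDl sumr_ge0.
  have := ler_norm x; lra.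
have sT : has_sup T by split=> //; exists (\sum_(x <- f) `|x|).
exists (sup T); split.
- by have [t tT] := nT; apply: le_trans (ub_le_sup (proj2 sT) tT); case: tT.
- move=> t /andP[t0 /(sup_gt nT) [t1 [t10 h1] tt1]].
  exact: profile_le_below h1.
- move=> t st; rewrite leNgt; apply/negP => h.
  have : T t.
    split=> //; have [t' tT'] := nT.
    by apply: le_trans (ltW st); apply: le_trans (ub_le_sup (proj2 sT) tT'); case: tT'.
  by move=> /(ub_le_sup (proj2 sT)); rewrite leNgt st.
Qed.

Hypothesis f_ge0 : {in f, forall x, 0 <= x}.
Hypothesis F_ge0 : {in F, forall x, 0 <= x}.
Hypothesis fF : forall t, num_ge f t <= num_ge F t.
Hypothesis alE : al * G = m.+1%:R * \sum_(y <- F) y.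

(** The hypothesis [alE] says that the profile and the level count of F have the
same integral. *)
Lemma berwald_moment : (\sum_(x <- f) x ^+ m.+2) / m.+2%:R <=
  G * al ^+ m.+2 * (m.+1`! * m`!)%:R / ((2 * m.+1)`!)%:R.
Proof.
have G0 : 0 < G by rewrite ltr0n.
have [ts [ts0 below above]] := crossing.
pose w := ts ^+ m.+1; pose k := G / al ^+ m.
have w0 : 0 <= w by rewrite exprn_ge0.
have k0 : 0 <= k by rewrite divr_ge0 ?exprn_ge0 // ltW.
pose L := [seq (1 : R, (m.+1, 0%N, x)) | x <- f] ++ [:: (w * k, (0%N, m, al))].
pose M := [seq (w, (0%N, 0%N, y)) | y <- F] ++ [:: (k, (m.+1, m, al))].
have := @wsum_comparison R L M.
rewrite /L /M !big_cat !big_map !big_seq1 /=.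
have fact0 i : i`!%:R != 0 :> R by rewrite pnatr_eq0 -lt0n fact_gt0.
have n0 i : i.+1%:R != 0 :> R by rewrite pnatr_eq0.
have aln0 : al ^+ m != 0 by rewrite expf_eq0 gt_eqF ?andbF.
have e1 (x : R) : 1 * bump_mass m.+1 0 x = x ^+ m.+2 / m.+2%:R.
  rewrite mul1r /bump_mass addn0 muln1 (factS m.+1) (natrM _ m.+2 m.+1`!).
  by move: (fact0 m.+1) (n0 m.+1); move: (m.+1`!%:R : R) (m.+2%:R : R) => u v hu hv; field; rewrite hu hv.
have e2 : w * k * bump_mass 0 m al = w * \sum_(y <- F) y.
  rewrite -[X in _ = w * X](mulKf (n0 m)) -alE /k /bump_mass add0n mul1n (factS m) (natrM _ m.+1 m`!).
  rewrite exprS; move: (fact0 m) (n0 m); move: (m`!%:R : R) (m.+1%:R : R) => u v hu hv.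
  by field; rewrite hu hv aln0.
have e3 (y : R) : bump_mass 0 0 y = y by rewrite /bump_mass expr1 divr1 mulr1.
have e4 : k * bump_mass m.+1 m al = G * al ^+ m.+2 * (m.+1`! * m`!)%:R / ((2 * m.+1)`!)%:R.
  have -> : (2 * m.+1)%N = (m.+1 + m).+1 by lia.
  rewrite /k /bump_mass (_ : (m.+1 + m).+1 = m.+2 + m)%N; last by lia.
  by rewrite exprD; field; rewrite aln0 fact0.
under eq_bigr do rewrite e1.
rewrite -mulr_suml e2 -mulr_sumr e4; under [X in _ -> _ -> _ -> _ <= w * X + _]eq_bigr do rewrite e3.
move=> H; suff : (\sum_(x <- f) x ^+ m.+2) / m.+2%:R + w * (\sum_(x <- F) x)
  <= w * (\sum_(x <- F) x) + G * al ^+ m.+2 * (m.+1`! * m`!)%:R / ((2 * m.+1)`!)%:R.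
  by rewrite addrC lerD2l.
apply: H.
- move=> p; rewrite mem_cat => /orP[/mapP[x xf ->]|]; first by split=> //=; exact: f_ge0.
  by rewrite inE => /eqP-> /=; rewrite mulr_ge0 // (ltW al0).
- move=> p; rewrite mem_cat => /orP[/mapP[x xf ->]|]; first by split=> //=; exact: F_ge0.
  by rewrite inE => /eqP-> /=; rewrite (ltW al0).
move=> t t0; rewrite /wsum !big_cat !big_map !big_seq1 /= -mulrA -/(profile m G al t).
rewrite -!mulr_sumr mul1r.
have -> : \sum_(x <- f) bump m.+1 0 x t = t ^+ m.+1 * num_ge f t.
  by rewrite mulr_sumr; apply: eq_bigr => x _; rewrite /bump expr0 mulr1.
have -> : \sum_(x <- F) bump 0 0 x t = num_ge F t.
  by apply: eq_bigr => x _; rewrite /bump !expr0 !mul1r.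
have -> : k * bump m.+1 m al t = t ^+ m.+1 * profile m G al t.
  by rewrite /profile /bump -/k expr0; ring.
have h0 := profile_ge0 m (ltW G0) al0 t0.
have Nf := num_ge_ge0 f t.
have NF := fF t; set u := t ^+ m.+1.
have u0 : 0 <= u by rewrite exprn_ge0.
(* Each case writes the difference as a product of same-sign factors plus a
   multiple of N' - N. *)
have [lt|gt|et] := ltgtP t ts.
- have uw : u <= w by rewrite lerXn2r ?nnegrE // ltW.
  have := below t; rewrite t0 lt => /(_ isT) hF.
  have A : 0 <= (w - u) * (num_ge F t - profile m G al t) by rewrite mulr_ge0 ?subr_ge0.
  have B : 0 <= u * (num_ge F t - num_ge f t) by rewrite mulr_ge0 ?subr_ge0.
  by rewrite -subr_ge0; move: (addr_ge0 A B); congr (_ <= _); ring.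
- have uw : w <= u by rewrite lerXn2r ?nnegrE // ltW.
  have hF := above t gt.
  have A : 0 <= (u - w) * (profile m G al t - num_ge f t) by rewrite mulr_ge0 ?subr_ge0.
  have B : 0 <= w * (num_ge F t - num_ge f t) by rewrite mulr_ge0 ?subr_ge0.
  by rewrite -subr_ge0; move: (addr_ge0 A B); congr (_ <= _); ring.
- have -> : u = w by rewrite /u et.
  by rewrite lerD2r ler_wpM2l.
Qed.

End Crossing.
End Berwald.

(** * Lattice points as integer sequences *)

Section Lattice.
Variables (R : realType) (d : nat).
Implicit Types (s : seq int) (A X : set 'rV[R]_d.+1).

Lemma dot_e_n (x : 'rV[R]_d.+1) : dot x (@e_n R d) = x 0 ord_max.
Proof.
rewrite /dot mxE (bigD1 ord_max) //= big1 => [|j jn].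
  by rewrite !mxE !eqxx mulr1 addr0.
by rewrite !mxE (negPf jn) andbF mulr0.
Qed.

(** A sequence of size d gives a point of the hyperplane: the last coordinate
falls outside the sequence and reads as 0. *)
Definition pt s : 'rV[R]_d.+1 := \row_j (s`_j)%:~R.

Lemma pt_en_perp s : (size s <= d)%N -> en_perp (pt s).
Proof. by move=> sd; rewrite /en_perp /= dot_e_n mxE nth_default. Qed.

Lemma pt_lattice s : (size s <= d)%N -> (en_perp `&` Zn) (pt s).
Proof.
move=> sd; split; first exact: pt_en_perp.
by move=> j; rewrite mxE intr_int.
Qed.

Lemma lattice_pt y : (@en_perp R d `&` Zn) y -> exists2 s, size s = d & y = pt s.
Proof.
move=> [yp yZ]; exists (mkseq (fun i => Num.floor (y 0 (inord i))) d).
  by rewrite size_mkseq.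
apply/rowP => j; rewrite mxE; have := ltn_ord j; rewrite ltnS leq_eqVlt.
move=> /orP[/eqP jd|jd].
  rewrite nth_default ?size_mkseq ?jd //.
  rewrite (_ : j = ord_max); last exact/val_inj.
  by move: yp; rewrite /en_perp /= dot_e_n => ->.
by rewrite nth_mkseq // inord_val floorK.
Qed.

Lemma pt_inj s s' : size s = d -> size s' = d -> pt s = pt s' -> s = s'.
Proof.
move=> sd sd' /rowP e; apply: (@eq_from_nth _ 0); first by rewrite sd.
move=> i; rewrite sd => id.
have := e (Ordinal (leq_trans id (leqnSn d))); rewrite !mxE /=.
by move/intr_inj.
Qed.

Lemma map_pt_uniq (B : seq (seq int)) : uniq B -> {in B, forall s, size s = d} ->
  uniq (map pt B).
Proof.
move=> uB sB; rewrite map_inj_in_uniq // => s s' sB1 sB2.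
by apply: pt_inj; exact: sB.
Qed.

Lemma vol1_fiber_ge0 A y : (0 <= vol1_fiber A y)%E.
Proof. by []. Qed.

Lemma mu_ge_sum A (B : seq (seq int)) : uniq B -> {in B, forall s, size s = d} ->
  (\sum_(s <- B) vol1_fiber A (pt s) <= mu A)%E.
Proof.
move=> uB sB; apply: esum_ge; exists [set` map pt B].
  split; first exact: finite_seq.
  move=> _ /= /mapP[s /sB sd ->]; apply: pt_lattice.
  by rewrite sd.
by rewrite -fsbig_seq ?map_pt_uniq // big_map.
Qed.

Lemma mu_eq_sum A (B : seq (seq int)) : uniq B -> {in B, forall s, size s = d} ->
  (forall s, size s = d -> s \notin B -> vol1_fiber A (pt s) = 0%E) ->
  mu A = (\sum_(s <- B) vol1_fiber A (pt s))%E.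
Proof.
move=> uB sB A0.
have BZ : [set` map pt B] `<=` @en_perp R d `&` Zn.
  by move=> _ /= /mapP[s /sB sd ->]; apply: pt_lattice; rewrite sd.
have -> : mu A = \esum_(y in [set` map pt B]) vol1_fiber A y.
  rewrite /mu esum_mkcond [RHS]esum_mkcond; apply: eq_esum => y _.
  have [yZ|yZ] := pselect ((@en_perp R d `&` Zn) y); last first.
    by rewrite (memNset yZ) memNset // => /BZ.
  rewrite (mem_set yZ); have [yB|yB] := pselect ([set` map pt B] y).
    by rewrite (mem_set yB).
  rewrite (memNset yB); have [s sd ys] := lattice_pt yZ.
  rewrite ys; apply: A0 => //; apply/negP => sB'; apply: yB.
  by rewrite ys /=; exact: map_f.
rewrite esum_fset //; last exact: finite_seq.
by rewrite -fsbig_seq ?map_pt_uniq // big_map.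
Qed.

Lemma latcount_eq A (B : seq (seq int)) : uniq B -> {in B, forall s, size s = d} ->
  A `<=` @en_perp R d ->
  (forall s, size s = d -> (s \in B <-> A (pt s))) ->
  latcount A = (size B)%:R%:E.
Proof.
move=> uB sB Ap AB.
have -> : latcount A = counting [set` [fset y in map pt B]%fset] .
  congr counting; apply/seteqP; split => y.
    move=> [Ay yZ]; have [s sd ys] := lattice_pt (conj (Ap _ Ay) yZ).
    by rewrite /= ys !inE; apply: map_f; apply/(AB _ sd); rewrite -ys.
  rewrite /= !inE => /mapP[s sB' ->]; split; first exact/(AB _ (sB _ sB')).
  by have [] := @pt_lattice s; rewrite ?(sB _ sB').
rewrite /counting asboolT; last exact: finite_fset.
rewrite set_fsetK card_fseq undup_id ?map_pt_uniq // size_map //.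
Qed.

Definition int_range (N : nat) : seq int := [seq i%:Z - N%:Z | i <- iota 0 (2 * N).+1].

Lemma mem_int_range N (k : int) : (k \in int_range N) = (`|k| <= N%:Z).
Proof.
apply/mapP/idP => [[i]|kN]; first by rewrite mem_iota; lia.
by exists (absz (k + N%:Z)); rewrite ?mem_iota; lia.
Qed.

Lemma int_range_uniq N : uniq (int_range N).
Proof. by rewrite map_inj_uniq ?iota_uniq // => i j; lia. Qed.

Fixpoint box N m : seq (seq int) :=
  if m is m'.+1 then [seq k :: s | k <- int_range N, s <- box N m'] else [:: [::]].

Lemma mem_box N m s :
  (s \in box N m) = (size s == m) && all (fun k => `|k| <= N%:Z) s.
Proof.
elim: m s => [|m IH] s; first by case: s.
apply/allpairsP/idP => [[[k s'] /= [kN + ->]]|].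
  by rewrite IH /= eqSS -mem_int_range kN.
case: s => //= k s; rewrite eqSS => /and3P[sm kN sN].
by exists (k, s); rewrite /= mem_int_range kN IH sm sN.
Qed.

Lemma box_uniq N m : uniq (box N m).
Proof.
elim: m => // m IH; apply: allpairs_uniq_dep => //; first exact: int_range_uniq.
by move=> [k s] [k' s'] /= _ _ [-> ->].
Qed.

End Lattice.

(** * Fibres of a convex body *)

Section Fibers.
Variables (R : realType) (d : nat).
Implicit Types (A X : set 'rV[R]_d.+1) (x y : 'rV[R]_d.+1).
Local Notation e := (@e_n R d).
Definition fiber A y : set R := [set t : R | A (y + t *: e)].

Lemma itv_measure (a b : R) : a <= b ->
  @lebesgue_measure R `[a, b] = (b - a)%:E.
Proof.
move=> ab; rewrite lebesgue_measure_itv /= lte_fin EFinB.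
case: ltP => // ba; have -> : a = b by apply/eqP; rewrite eq_le ab.
by rewrite -EFinB subrr.
Qed.

(** Monotonicity on arbitrary sets, since this measure is an outer measure
defined on all sets. *)
Lemma lebesgue_le (A B : set R) : A `<=` B ->
  (@lebesgue_measure R A <= @lebesgue_measure R B)%E.
Proof. by move=> AB; apply: (@le_mu_ext _ _ _ (wlength idfun)). Qed.

Variable K : set 'rV[R]_d.+1.
Hypothesis cK : compact K.
Hypothesis convK : convex_set K.

Lemma convexE x y (l : R) : 0 <= l <= 1 -> K x -> K y ->
  K ((1 - l) *: x + l *: y).
Proof.
move=> /andP[l0 l1] Kx Ky.
have := convK (Itv01 l0 l1) (mem_set Ky) (mem_set Kx).
by rewrite inE /conv /= addrC.
Qed.

Lemma bounded_coord : exists N : nat, forall x j, K x -> `|x 0 j| <= N%:R.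
Proof.
have [M [_ HM]] := compact_bounded cK.
exists (Num.bound `|M + 1|) => x j Kx.
have : `|x| <= M + 1 by apply: (HM (M + 1)) => //; rewrite ltrDl.
move=> h; apply: (@le_trans _ _ `|x|).
  by rewrite [leRHS]/Num.norm /= mx_normrE; apply: (le_bigmax _ (fun ij => `|x ij.1 ij.2|) (0, j)).
apply: le_trans h _; apply: le_trans (ler_norm _) _.
by apply/ltW; apply: archi_boundP.
Qed.

Lemma fiber_compact y : compact (fiber K y).
Proof.
have [N HN] := bounded_coord.
have sub : fiber K y `<=` `[- (N%:R + `|y 0 ord_max|), N%:R + `|y 0 ord_max|].
  move=> t /(HN _ ord_max); rewrite !mxE !eqxx mulr1 => h.
  rewrite /= in_itv /= -ler_norml.
  have -> : t = (y 0 ord_max + t) - y 0 ord_max by ring.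
  by rewrite (le_trans (ler_normB _ _)) // lerD2r.
apply: subclosed_compact sub; last exact: segment_compact.
apply: (@closed_comp _ _ (fun t : R => y + t *: e)).
  move=> t _; apply: cvgD; first exact: cvg_cst.
  by apply: cvgZr_tmp; exact: cvg_id.
exact: compact_closed.
Qed.

Lemma fiberP y : fiber K y = set0 \/
  exists a b, a <= b /\ fiber K y = `[a, b]%classic.
Proof.
have [->|/set0P ne] := eqVneq (fiber K y) set0; [by left|right].
have idc : {within fiber K y, continuous (fun t : R => t)}.
  by apply: continuous_subspaceT => t; exact: cvg_id.
have oppc : {within fiber K y, continuous (fun t : R => - t)}.
  by apply: continuous_subspaceT => t; exact: opp_continuous.
have [b bf hb] := compact_EVT_max ne (@fiber_compact y) idc.
have [a af ha] := compact_EVT_max ne (@fiber_compact y) oppc.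
exists a, b; rewrite !inE in af bf; split; first by apply: hb; rewrite inE.
apply/seteqP; split => t; rewrite /= in_itv /=.
  by move=> tf; rewrite -(lerN2 t a) ha ?hb ?inE.
have [ab|ab] := eqVneq a b.
  by rewrite -ab -eq_le => /eqP <-.
have ab0 : b - a != 0 by rewrite subr_eq0 eq_sym.
have {}ab : a < b by rewrite lt_def eq_sym ab hb // inE.
move=> /andP[t1 t2]; pose l := (t - a) / (b - a).
have l01 : 0 <= l <= 1.
  by rewrite divr_ge0 ?subr_ge0 ?(ltW ab) // ler_pdivrMr ?subr_gt0 // mul1r lerD2r.
have := convexE l01 af bf.
have -> : (1 - l) *: (y + a *: e) + l *: (y + b *: e) = y + t *: e; last by [].
rewrite !scalerDr addrACA -scalerDl subrK scale1r !scalerA -scalerDl.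
by congr (_ + _ *: _); rewrite /l; field.
Qed.

Definition len y : R := fine (vol1_fiber K y).

Lemma vol1_fiberE y : vol1_fiber K y = (len y)%:E.
Proof.
rewrite /len /vol1_fiber -/(fiber K y); case: (fiberP y) => [->|[a [b [ab ->]]]].
  by rewrite measure0.
by rewrite itv_measure.
Qed.

Lemma len_ge0 y : 0 <= len y.
Proof. by rewrite -lee_fin -vol1_fiberE vol1_fiber_ge0. Qed.

Lemma len_eq0 y : fiber K y = set0 -> len y = 0.
Proof. by rewrite /len /vol1_fiber -/(fiber K y) => ->; rewrite measure0. Qed.

Lemma len_itv y a b : a <= b -> fiber K y = `[a, b]%classic -> len y = b - a.
Proof. by move=> ab h; rewrite /len /vol1_fiber -/(fiber K y) h itv_measure. Qed.

(** For a fibre [a, b] the intersection with its translate by r >= 0 is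
[a + r, b], of length (b - a) - r when this is nonnegative. *)
Lemma fiber_translate_inter y r : 0 <= r ->
  vol1_fiber (K `&` minkowski_sum [set r *: e] K) y = (bump 0 1 (len y) r)%:E.
Proof.
move=> r0.
have -> : vol1_fiber (K `&` minkowski_sum [set r *: e] K) y =
   @lebesgue_measure R (fiber K y `&` [set t | fiber K y (t - r)]).
  congr lebesgue_measure; apply/seteqP; split=> t [Kt].
    move=> [_ -> [k Kk]] /= h; split=> //; rewrite /fiber /=.
    suff -> : y + (t - r) *: e = k by [].
    by rewrite scalerBl addrA -h addrAC subrr add0r.
  rewrite /fiber /= => h; split=> //; exists (r *: e) => //; exists (y + (t - r) *: e) => //.
  by rewrite addrCA -scalerDl [r + _]addrC subrK.
rewrite /bump expr0 mul1r expr1.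
case: (fiberP y) => [h|[a [b [ab h]]]].
  rewrite h set0I measure0 (len_eq0 h) sub0r; congr (_%:E).
  by case: leP => h'; rewrite /= ?mulr0 // mulr1; apply/esym/eqP; rewrite oppr_eq0 eq_le h'.
rewrite (len_itv ab h) h.
have -> : `[a, b]%classic `&` [set t : R | `[a, b]%classic (t - r)] = `[a + r, b]%classic.
  apply/seteqP; split => t; rewrite /= !in_itv /=.
    by move=> [/andP[? ?] /andP[? ?]]; apply/andP; split; lra.
  by move=> /andP[? ?]; split; apply/andP; split; lra.
case: leP => h'; rewrite /= ?mulr0 ?mulr1.
  by rewrite itv_measure; [congr (_%:E); ring|lra].
by rewrite set_itv_ge ?measure0 // bnd_simp -ltNge; lra.
Qed.

(** Convexity puts the combination of the end points of two fibres into the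
intermediate fibre: this is concavity of the length on the projection. *)
Lemma len_concave x y (l : R) : 0 <= l <= 1 -> fiber K x !=set0 -> fiber K y !=set0 ->
  fiber K ((1 - l) *: x + l *: y) !=set0 /\
  (1 - l) * len x + l * len y <= len ((1 - l) *: x + l *: y).
Proof.
move=> l01 [t0 ht0] [t1 ht1].
case: (fiberP x) => [h|[a [b [ab h]]]]; first by rewrite h in ht0.
case: (fiberP y) => [h'|[a' [b' [ab' h']]]]; first by rewrite h' in ht1.
have comb s t : fiber K x s -> fiber K y t ->
    fiber K ((1 - l) *: x + l *: y) ((1 - l) * s + l * t).
  move=> Ks Kt; have := convexE l01 Ks Kt.
  rewrite /fiber /=; congr K.
  by rewrite (scalerDl e ((1 - l) * s)) -!scalerA !scalerDr addrACA.
split; first by exists ((1 - l) * t0 + l * t1); exact: comb.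
have ca : fiber K ((1 - l) *: x + l *: y) ((1 - l) * a + l * a').
  by apply: comb; rewrite ?h ?h' /= in_itv /= lexx.
have cb : fiber K ((1 - l) *: x + l *: y) ((1 - l) * b + l * b').
  by apply: comb; rewrite ?h ?h' /= in_itv /= lexx ?andbT.
rewrite (len_itv ab h) (len_itv ab' h').
case: (fiberP ((1 - l) *: x + l *: y)) => [e0|[a'' [b'' [ab'' e0]]]].
  by rewrite e0 in ca.
rewrite (len_itv ab'' e0); move: ca cb; rewrite e0 /= !in_itv /=.
by move=> /andP[? _] /andP[_ ?]; lra.
Qed.

Lemma proj_fiber y : en_perp y -> (proj_en_perp @` K) y <-> fiber K y !=set0.
Proof.
rewrite /en_perp /= dot_e_n => y0; split.
  move=> [x Kx xy]; exists (dot x e); rewrite /fiber /= -xy /proj_en_perp.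
  by rewrite subrK.
move=> [t Kt]; exists (y + t *: e) => //.
by rewrite /proj_en_perp dot_e_n !mxE y0 !eqxx add0r mulr1 addrK.
Qed.

Lemma proj_sub_perp : proj_en_perp @` K `<=` @en_perp R d.
Proof.
move=> _ [x Kx <-]; rewrite /en_perp /= dot_e_n /proj_en_perp !mxE dot_e_n.
by rewrite !eqxx mulr1 subrr.
Qed.

(** The symmetrized fibre over p is translated by z - p, which lies in the cube,
into the fibre over z. *)
Lemma steiner_fiber_ge p z : en_perp p -> fiber K p !=set0 -> cube (z - p) ->
  ((len p)%:E <= vol1_fiber (minkowski_sum (steiner K) cube) z)%E.
Proof.
move=> pp Kp zp.
have -> : (len p)%:E = @lebesgue_measure R `[- (len p / 2), len p / 2].
  rewrite itv_measure; first by congr (_%:E); field.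
  by rewrite ge0_cp ?divr_ge0 ?len_ge0.
apply: lebesgue_le => t; rewrite /= in_itv /= -ler_norml => tl.
exists (p + t *: e).
  exists p, t; split=> //; first exact/proj_fiber.
  by rewrite vol1_fiberE -EFinM lee_fin mulrC.
by exists (z - p) => //; rewrite addrC addrA subrK.
Qed.

End Fibers.

(** * Discrete Berwald inequality for the fibre length *)

Section Assembly.
Variables (R : realType) (d : nat) (K : set 'rV[R]_d.+1) (N : nat).
Hypothesis cK : compact K.
Hypothesis convK : convex_set K.
Hypothesis KN : forall x j, K x -> `|x 0 j| <= N%:R.
Local Notation e := (@e_n R d).
Local Notation pt := (@pt R d).

Definition base_points : seq (seq int) :=
  [seq s <- box N.+1 d | `[< fiber K (pt s) !=set0 >]].
Local Notation A := base_points.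

Lemma fiber_coord y j : j != ord_max -> fiber K y !=set0 -> `|y 0 j| <= N%:R.
Proof.
move=> jn [t /(KN j)]; rewrite !mxE eqxx (negPf jn) mulr0 addr0.
by [].
Qed.

(** Lattice points at distance < 1 from the projection of K have coordinates at
most N + 1 in absolute value, so one finite box contains all the points that
matter. *)
Lemma near_box p s : size s = d -> fiber K p !=set0 ->
  (forall j, j != ord_max -> `|pt s 0 j - p 0 j| < 1) -> s \in box N.+1 d.
Proof.
move=> sd pK sp; rewrite mem_box sd eqxx; apply/(all_nthP 0) => i.
rewrite sd => id; pose j : 'I_d.+1 := Ordinal (leq_trans id (leqnSn d)).
have jn : j != ord_max by rewrite -val_eqE /= neq_ltn id.
have h1 := fiber_coord jn pK; have h2 := sp _ jn.
have : `|pt s 0 j| < N%:R + 1.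
  have -> : pt s 0 j = p 0 j + (pt s 0 j - p 0 j) by ring.
  exact: le_lt_trans (ler_normD _ _) (ler_ltD h1 h2).
by rewrite mxE /= -intr_norm natr1 (ltr_int R _ N.+1) => /ltW.
Qed.

Lemma mem_base s : size s = d -> (s \in A) <-> fiber K (pt s) !=set0.
Proof.
move=> sd; rewrite mem_filter; split; first by move=> /andP[/asboolP].
move=> h; apply/andP; split; first exact/asboolP.
by apply: (near_box sd h) => j _; rewrite subrr normr0 ltr01.
Qed.

Lemma base_size : {in A, forall s, size s = d}.
Proof. by move=> s; rewrite mem_filter mem_box => /and3P[_ /eqP]. Qed.

Lemma base_uniq : uniq A.
Proof. by rewrite filter_uniq // box_uniq. Qed.

Lemma latcount_proj : latcount (proj_en_perp @` K) = (size A)%:R%:E.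
Proof.
apply: latcount_eq; [exact: base_uniq|exact: base_size|exact: proj_sub_perp|].
move=> s sd; apply: (iff_trans (mem_base sd)); apply: iff_sym; apply: proj_fiber.
by apply: pt_en_perp; rewrite sd.
Qed.

Lemma mu_translate_inter r : 0 <= r ->
  mu (K `&` minkowski_sum [set r *: e] K) =
  (\sum_(s <- A) bump 0 1 (len K (pt s)) r)%:E.
Proof.
move=> r0; rewrite (mu_eq_sum base_uniq base_size).
  by rewrite -sumEFin; apply: eq_bigr => s _; rewrite fiber_translate_inter.
move=> s sd sA; rewrite fiber_translate_inter // len_eq0 /bump.
  rewrite expr0 mul1r expr1 sub0r; congr (_%:E); case: leP => h; rewrite /= ?mulr0 //.
  by rewrite mulr1; apply/eqP; rewrite oppr_eq0 eq_le h.
by apply/eqP; apply/negPn/negP => /set0P h; move: sA; rewrite (mem_base sd).2.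
Qed.

(** Exchanging sum and integral reduces the moment of the covariogram to the
Beta integral of r^d (c - r) over [0, c], for each fibre length c. *)
Lemma covariogram_moment :
  (\int[@lebesgue_measure R]_(r in `[0%R, +oo[)
     ((r ^+ d)%:E * mu (K `&` minkowski_sum [set r *: e] K)) =
   ((\sum_(s <- A) len K (pt s) ^+ d.+2) * d`!%:R / d.+2`!%:R)%:E)%E.
Proof.
pose L := [seq (1 : R, (d, 1%N, len K (pt s))) | s <- A].
transitivity (\int[@lebesgue_measure R]_(r in `[0%R, +oo[) (wsum L r)%:E)%E.
  apply: eq_integral => r; rewrite inE /= in_itv /= andbT => r0.
  rewrite mu_translate_inter // -EFinM /wsum big_map mulr_sumr; congr (_%:E).
  by apply: eq_bigr => s _; rewrite /bump /= mul1r expr0; ring.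
rewrite integral_wsum; last first.
  by move=> _ /mapP[s _ ->] /=; rewrite ler01 len_ge0.
rewrite big_map !mulr_suml; congr (_%:E); apply: eq_bigr => s _ /=.
by rewrite mul1r /bump_mass addn1 muln1.
Qed.

Local Notation SC := (minkowski_sum (steiner K) (@cube R d)).

(** The point p = (1 - l) x + l y of the projection has fibre length at least the
combination of those over x and y, and z is within the open cube around p. *)
Lemma steiner_near_ge l x y z : 0 <= l <= 1 -> x \in A -> y \in A -> size z = d ->
  near_comb l x y z -> z \in box N.+1 d /\
  (((1 - l) * len K (pt x) + l * len K (pt y))%:E <= vol1_fiber SC (pt z))%E.
Proof.
move=> l01 xA yA zd nz.
have [/mem_base fx /mem_base fy] := (base_size xA, base_size yA).
have [fp lp] := len_concave cK convK l01 (fx.1 xA) (fy.1 yA).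
set p := (1 - l) *: pt x + l *: pt y in fp lp.
have pE j : p 0 j = (1 - l) * (x`_j)%:~R + l * (y`_j)%:~R by rewrite !mxE.
have zp j : `|pt z 0 j - p 0 j| < 1 by rewrite mxE pE; exact: nz.
split; first by apply: (near_box zd fp) => j _.
have last0 : (pt z - p) 0 ord_max = 0.
  by rewrite !mxE !nth_default ?zd ?base_size //= !mulr0 addr0 subrr.
have perp : en_perp p.
  by rewrite /en_perp /= dot_e_n pE !nth_default ?base_size //= !mulr0 addr0.
apply: (@le_trans _ _ (len K p)%:E); first by rewrite lee_fin.
apply: steiner_fiber_ge => //; split=> // j _.
by rewrite -ltr_norml; have := zp j; rewrite !mxE.
Qed.

Lemma num_ge_map (B : seq (seq int)) (g : seq int -> R) t :
  num_ge (map g B) t = (size [seq s <- B | t <= g s])%:R.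
Proof. by rewrite num_geE size_filter count_map -size_filter. Qed.

Variable u : R.
Hypothesis SCu : mu SC = u%:E.
Let F z := fine (vol1_fiber SC (pt z)).

Lemma FE z : size z = d -> vol1_fiber SC (pt z) = (F z)%:E.
Proof.
move=> zd; rewrite fineK // ge0_fin_numE // (@le_lt_trans _ _ (mu SC)) ?SCu ?ltry //.
rewrite -SCu; have := @mu_ge_sum R d SC [:: z] isT.
by rewrite big_seq1; apply => s; rewrite inE => /eqP->.
Qed.

Lemma sum_F_le : \sum_(z <- box N.+1 d) F z <= u.
Proof.
have sb : {in box N.+1 d, forall s, size s = d}.
  by move=> s; rewrite mem_box => /andP[/eqP].
rewrite -lee_fin -SCu; apply: le_trans (mu_ge_sum SC (box_uniq N.+1 d) sb).
rewrite -sumEFin big_seq [leRHS]big_seq le_eqVlt; apply/orP; left; apply/eqP.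
by apply: eq_bigr => s /sb sd; rewrite FE.
Qed.

Lemma F_ge0 z : 0 <= F z.
Proof. by rewrite fine_ge0. Qed.

Lemma len_le_F s : s \in A -> len K (pt s) <= F s.
Proof.
move=> sA; have sd := base_size sA.
have l01 : 0 <= (1 : R) <= 1 by rewrite ler01 lexx.
have nr : near_comb (1 : R) s s s.
  by move=> k; rewrite subrr mul0r add0r mul1r subrr normr0.
have [_] := steiner_near_ge l01 sA sA sd nr.
by rewrite FE // lee_fin subrr mul0r add0r mul1r.
Qed.

(** The Brunn-Minkowski hypothesis of the crossing argument, for all lattice
points of the projection and those with fibre length at least t1. *)
Lemma level_sets_BM (t1 l a b : R) : 0 <= t1 -> has (>= t1) [seq len K (pt s) | s <- A] ->
  0 <= l <= 1 -> 0 <= a -> 0 <= b ->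
  a ^+ d <= (size [seq len K (pt s) | s <- A])%:R ->
  b ^+ d <= num_ge [seq len K (pt s) | s <- A] t1 ->
  ((1 - l) * a + l * b) ^+ d <= num_ge [seq F z | z <- box N.+1 d] (l * t1).
Proof.
move=> t10 hasA l01 a0 b0; rewrite size_map !num_ge_map => aA bB.
pose B := [seq s <- A | t1 <= len K (pt s)].
have B0 : B != [::] by rewrite -has_filter -(has_map (fun s => len K (pt s)) (>= t1)).
have A0 : A != [::] by move: B0; rewrite /B; case: (A).
have BA : {subset B <= A} by move=> s; rewrite mem_filter => /andP[].
have [|D [uD sD nD cD]] := discrete_BM l01 base_uniq (filter_uniq _ base_uniq) A0 B0
  base_size _ a0 b0 aA bB; first by move=> s /BA /base_size.
apply: le_trans cD _; rewrite ler_nat; apply: uniq_leq_size => // z zD.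
have [x [y [xA yB nz]]] := nD _ zD.
have [zb] := steiner_near_ge l01 xA (BA _ yB) (sD _ zD) nz.
rewrite mem_filter zb andbT FE ?sD // lee_fin; apply: le_trans.
move: yB; rewrite mem_filter => /andP[ty _].
have /andP[l0 l1] := l01.
have h1 : 0 <= (1 - l) * len K (pt x) by rewrite mulr_ge0 ?subr_ge0 // len_ge0.
by rewrite ler_wpDl // ler_wpM2l.
Qed.

(** [berwald_moment] with the height al = (d + 1) S / G that equates the
integrals, S being the sum of F; the constants are collected through
C(2n, n) n! n! = (2n)!. *)
Lemma moment_le : has (> 0) [seq len K (pt s) | s <- A] ->
  'C(2 * d.+1, d.+1)%:R / d.+1%:R ^+ d.+1 * d.+1%:R *
    ((\sum_(s <- A) len K (pt s) ^+ d.+2) * d`!%:R / d.+2`!%:R) <=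
  u ^+ d.+2 / (size A)%:R ^+ d.+1.
Proof.
move=> hpos; pose f := [seq len K (pt s) | s <- A].
pose Fl := [seq F z | z <- box N.+1 d].
pose S := \sum_(y <- Fl) y.
have Abox : {subset A <= box N.+1 d} by move=> s; rewrite mem_filter => /andP[].
have sz : (0 < size f)%N by move: hpos; rewrite /f; case: [seq _ | _ <- _].
have G0 : 0 < (size f)%:R :> R by rewrite ltr0n.
have S0 : 0 < S.
  move: hpos => /hasP[_ /mapP[s sA ->] /= ls].
  rewrite /S big_map (big_rem _ (Abox _ sA)) /= ltr_pwDl ?sumr_ge0 //.
    by apply: lt_le_trans ls _; exact: len_le_F.
  by move=> z _; exact: F_ge0.
pose al := d.+1%:R * S / (size f)%:R.
have al0 : 0 < al by rewrite divr_gt0 // mulr_gt0 // ltr0n.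
have f1 : d = 0%N -> size f = 1%N.
  move=> d0; apply/eqP; rewrite eqn_leq sz andbT size_map.
  apply: (@uniq_leq_size _ A [:: [::]] base_uniq) => s /base_size.
  by rewrite d0 => /size0nil ->.
have f_ge0 : {in f, forall x, 0 <= x} by move=> _ /mapP[s _ ->]; exact: len_ge0.
have Fl_ge0 : {in Fl, forall x, 0 <= x} by move=> _ /mapP[s _ ->]; exact: F_ge0.
have fF t : num_ge f t <= num_ge Fl t.
  rewrite !num_ge_map ler_nat; apply: uniq_leq_size; first by rewrite filter_uniq ?base_uniq.
  move=> s; rewrite !mem_filter => /andP[ts sA]; apply/andP; split.
    by apply: le_trans ts _; apply: len_le_F; rewrite mem_filter.
  by case/andP: sA.
have alE : al * (size f)%:R = d.+1%:R * S by rewrite divfK // gt_eqF.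
have := berwald_moment al0 sz f1 level_sets_BM f_ge0 Fl_ge0 fF alE.
rewrite big_map; set P := \sum_(s <- A) _; rewrite /al size_map in G0 *.
have fact0 k : k`!%:R != 0 :> R by rewrite pnatr_eq0 -lt0n fact_gt0.
have n0 k : k.+1%:R != 0 :> R by rewrite pnatr_eq0.
have binE : ((2 * d.+1)`!)%:R = 'C(2 * d.+1, d.+1)%:R * (d.+1`!%:R * d.+1`!%:R) :> R.
  rewrite -!natrM -(@bin_fact (2 * d.+1) d.+1); last by lia.
  by rewrite mul2n -addnn addnK.
have c0 : 0 < 'C(2 * d.+1, d.+1)%:R :> R by rewrite ltr0n bin_gt0; lia.
have Su : S <= u by rewrite /S big_map sum_F_le.
have g0 : (size A)%:R != 0 :> R by rewrite gt_eqF.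
rewrite binE natrM; move=> H.
apply: (@le_trans _ _ (S ^+ d.+2 / (size A)%:R ^+ d.+1)); last first.
  rewrite ler_wpM2r ?invr_ge0 ?exprn_ge0 // lerXn2r // nnegrE ?(ltW S0) //.
  exact: le_trans (ltW S0) Su.
have cn0 : 0 <= 'C(2 * d.+1, d.+1)%:R / d.+1%:R ^+ d.+1 :> R.
  by rewrite divr_ge0 // exprn_ge0.
have := ler_wpM2l cn0 H; move: H => _.
rewrite (factS d.+1) (factS d) !(natrM _ _.+1) exprMn exprVn exprMn.
rewrite [(size A)%:R ^+ d.+2]exprS [X in _ <= _ * (_ * (X * _ / _) * _ / _)]exprS.
move: (n0 d) (n0 d.+1) (fact0 d) c0 => h1 h2 h3 /gt_eqF/negbT h4.
have h5 : d.+1%:R ^+ d.+1 != 0 :> R by rewrite expf_eq0 (negPf h1) andbF.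
have h6 : (size A)%:R ^+ d.+1 != 0 :> R by rewrite expf_eq0 (negPf g0) andbF.
move: ((size A)%:R ^+ d.+1) (d.+1%:R ^+ d.+1 : R) h5 h6 => gn nn h5 h6.
move: (size A)%:R g0 (S ^+ d.+2) ('C(2 * d.+1, d.+1)%:R : R) h4 h1 h2 h3 => g g0 sn c h4.
move: (d.+1%:R : R) (d.+2%:R : R) (d`!%:R : R) => n m q h1 h2 h3.
by congr (_ <= _); field; rewrite ?h1 ?h2 ?h3 ?h4 ?h5 ?h6 ?g0.
Qed.
End Assembly.

Theorem theorem1p2 (R : realType) (d : nat) (K : set 'rV[R]_d.+1)
    (hK : convex_body K)
    (hmax : is_maximum [set vol1_fiber K y | y in en_perp] (vol1_fiber K 0)) :
  (('C(2 * d.+1, d.+1)%:R / d.+1%:R ^+ d.+1 * d.+1%:R)%:E *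
     \int[@lebesgue_measure R]_(r in `[0%R, +oo[)
        ((r ^+ d)%:E * mu (K `&` minkowski_sum [set r *: e_n] K))
   <= mu (minkowski_sum (steiner K) cube) ^+ d.+2 /
      latcount (proj_en_perp @` K) ^+ d.+1)%E.
Proof.
have [cK convK _] := hK; have [N KN] := bounded_coord cK.
rewrite (covariogram_moment cK convK KN) (latcount_proj KN) -EFinM.
have mu0 : (0 <= mu (minkowski_sum (steiner K) (@cube R d)))%E.
  by apply: esum_ge0 => y _.
have inv0 : (0 <= (((size (base_points K N))%:R%:E : \bar R) ^+ d.+1)^-1)%E.
  by rewrite inve_ge0 expe_ge0 // lee_fin.
(* If every fibre over a lattice point has length 0, no conical profile exists,
   and G may be 0; but then the left-hand side vanishes. *)
have [hpos|hzero] := boolP (has (> 0) [seq len K (pt R d s) | s <- base_points K N]); last first.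
  rewrite big_seq big1 => [|s sA].
    by rewrite !mul0r mulr0; apply: mule_ge0 inv0; exact: expe_ge0.
  have -> : len K (pt R d s) = 0; last by rewrite exprS mul0r.
  apply/eqP; rewrite eq_le len_ge0 // andbT leNgt; apply/negP => h.
  by move/hasPn: hzero => /(_ _ (map_f _ sA)); rewrite /= h.
have G0 : (0 < size (base_points K N))%N by move: hpos; case: (base_points K N).
have Gn0 : (size (base_points K N))%:R != 0 :> R by rewrite pnatr_eq0 -lt0n.
rewrite -EFin_expe inver expf_eq0 (negPf Gn0) andbF.
case E : (mu _) mu0 => [u| |] // _.
  by rewrite -EFin_expe -EFinM lee_fin; exact: moment_le.
rewrite (_ : +oo ^+ d.+2 = +oo)%E; last first.
  by elim: (d.+1) => [|k IH]; rewrite ?expe1 // expeS IH mulyy.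
by rewrite gt0_mulye ?leey // lte_fin invr_gt0 exprn_gt0 // ltr0n.
Qed.
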